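(* Let $\alpha\in(0,1)$ and $\eta,\sigma>0$. The process $\bar X$ spends an infinite average amount of time at $\{0\}$ with each visit; that is, the holding times $\{\bar e_i\}_i$ of $\bar X$ at $\{0\}$ satisfy $\mathbf E[\bar e_i]=\infty$ for every $i$.
   Context: $A\circ B_t$ denotes $A_{B_t}$. $X^+$ is the reflecting Brownian motion on $[0,\infty)$ with generator $d^2/dx^2$, $\gamma^+_t=\gamma^+_{t,0}$ is its local time at $0$, where $\gamma^+_{t,z}$ is the jointly continuous local time with $\int_0^t h(X^+_s)ds=\int_0^\infty h(z)\gamma^+_{t,z}dz$. $H$ is an $\alpha$-stable subordinator independent of $X^+$ with $H_0=0$, $\mathbf E_0[e^{-\lambda H_t}]=e^{-t\lambda^\alpha}$. Put $\bar V_t=t+H\circ(\eta/\sigma)\gamma^+_t$ with inverse $\bar V^{-1}_t=\inf\{s:\bar V_s>t\}$; before any elastic killing, $\bar X_t=X^+\circ\bar V^{-1}_t$. The holding times $\{\bar e_i\}_i$ of $\bar X$ at $0$ are random variables, one for each visit $i$ to $0$, where the process started at $\bar X_0=0$ leaves the boundary point after the time $\bar e_i$. In the paper they are i.i.d. Mittag-Leffler random variables with law $$\mathbf P_0(\bar e_i>t\mid\bar X_{\bar e_i}>0)=E_\alpha(-(\sigma/\eta)t^\alpha),\qquad t\ge0,$$ with $E_\alpha(z)=\sum_{k\ge0}z^k/\Gamma(\alpha k+1)$, and $\mathbf E[\bar e_i]$ is the mean of this law. *)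

(* Defs.v *)
(* MathComp-Analysis *)
From HB Require Import structures.
From mathcomp Require Import all_boot all_order all_algebra.
From mathcomp Require Import all_classical all_reals all_analysis.

Set Implicit Arguments.
Unset Strict Implicit.
Unset Printing Implicit Defensive.

Import Order.TTheory GRing.Theory Num.Theory.
Import numFieldNormedType.Exports.

Local Open Scope classical_set_scope.
Local Open Scope ring_scope.

Definition Gamma (R : realType) (x : R) : R :=
  \int[lebesgue_measure]_(t in `]0%R, +oo[) (t `^ (x - 1) * expR (- t)).

Definition mittag_leffler (R : realType) (alpha z : R) : R :=
  limn (series (fun k : nat => z ^+ k / Gamma (alpha * k%:R + 1))).

(* P( . | B); it is the elementary conditional probability P (A `&` B) / P B
   when P B > 0, and P itself (a dummy value) when P B = 0. *)
Definition cond_prob d (T : measurableType d) (R : realType)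
    (P : probability T R) (B : set T) (mB : measurable B) : probability T R :=
  mnormalize (mrestr P mB) P.

(* sigma-algebra generated by the variables Y_t, t in D *)
Definition history d (T : measurableType d) (R : realType)
    (Y : R -> T -> R) (D : set R) : set (set T) :=
  <<s [set Y t @^-1` B | t in D & B in @measurable _ R] >>.

Definition independent_processes d (T : measurableType d) (R : realType)
    (P : probability T R) (Y Z : R -> T -> R) : Prop :=
  forall A B, history Y `[0%R, +oo[ A -> history Z `[0%R, +oo[ B ->
    P (A `&` B) = (P A * P B)%E.

(* Heat kernel of du/dt = d^2u/dx^2 on [0, +oo[ with the Neumann condition
   at 0 (method of images). The generator is d^2/dx^2, not (1/2) d^2/dx^2,
   hence the variance 2t of each Gaussian term. *)
Definition reflecting_kernel (R : realType) (t x y : R) : R :=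
  (expR (- (x - y) ^+ 2 / (4 * t)) + expR (- (x + y) ^+ 2 / (4 * t)))
  / Num.sqrt (4 * pi * t).

(* Reflecting Brownian motion on [0, +oo[ with generator d^2/dx^2, under P_0:
   the continuous Markov process started at 0 with the above transition
   densities. *)
Record reflecting_brownian_motion d (T : measurableType d) (R : realType)
    (P : probability T R) (X : R -> {RV P >-> R}) : Prop := {
  rbm_start : {ae P, forall w, X 0 w = 0} ;
  rbm_ge0 : {ae P, forall w, forall t : R, 0 <= t -> 0 <= X t w} ;
  rbm_continuous :
    {ae P, forall w, {within `[0%R, +oo[, continuous (fun t : R => X t w)}} ;
  rbm_markov : forall (s t : R) (A : set T) (B : set R), 0 <= s -> 0 < t ->
    history X `[0%R, s] A -> measurable B ->
    (P (A `&` X (s + t)%R @^-1` B) =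
     \int[P]_(w in A) \int[lebesgue_measure]_(y in B `&` `[0%R, +oo[)
       (reflecting_kernel t (X s w) y)%:E)%E }.

(* L t z w is the local time of X at level z up to time t *)
Record local_time d (T : measurableType d) (R : realType)
    (P : probability T R) (X : R -> {RV P >-> R}) (L : R -> R -> T -> R)
    : Prop := {
  loc_ge0 : {ae P, forall w, forall t z : R, 0 <= t -> 0 <= z -> 0 <= L t z w} ;
  loc_continuous : {ae P, forall w,
    {within [set tz : R * R | 0 <= tz.1 /\ 0 <= tz.2],
      continuous (fun tz : R * R => L tz.1 tz.2 w)}} ;
  loc_occupation : {ae P, forall w, forall (t : R) (h : R -> R),
    0 <= t -> measurable_fun [set: R] h -> (forall z, 0 <= h z) ->
    (\int[lebesgue_measure]_(s in `[0%R, t]) (h (X s w))%:E =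
     \int[lebesgue_measure]_(z in `[0%R, +oo[) (h z * L t z w)%:E)%E} }.

Record stable_subordinator d (T : measurableType d) (R : realType)
    (P : probability T R) (alpha : R) (H : R -> {RV P >-> R}) : Prop := {
  sub_start : {ae P, forall w, H 0 w = 0} ;
  sub_nondecreasing : {ae P, forall w, forall s t : R,
    0 <= s -> s <= t -> H s w <= H t w} ;
  sub_right_continuous : {ae P, forall w, forall t : R, 0 <= t ->
    H s w @[s --> t^'+] --> H t w} ;
  sub_independent : forall (s t : R) (A : set T) (B : set R), 0 <= s -> 0 <= t ->
    history H `[0%R, s] A -> measurable B ->
    P (A `&` [set w | B (H (s + t) w - H s w)]) =
    (P A * P [set w | B (H (s + t)%R w - H s w)%R])%E ;
  sub_stationary : forall (s t : R) (B : set R), 0 <= s -> 0 <= t -> measurable B ->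
    P [set w | B (H (s + t) w - H s w)] = P (H t @^-1` B) ;
  sub_laplace : forall t l : R, 0 <= t -> 0 <= l ->
    ('E_P[fun w => expR (- l * H t w)] = (expR (- t * l `^ alpha))%R%:E)%E }.

Section paths.
Context {R : realType} {T : Type}.
Variables (eta sigma : R) (X H : R -> T -> R) (L : R -> R -> T -> R).

Definition Vbar (t : R) (w : T) : R := t + H (eta / sigma * L t 0 w) w.

Definition Vbar_inv (t : R) (w : T) : R :=
  inf [set s | 0 <= s /\ t < Vbar s w].

Definition Xbar (t : R) (w : T) : R := X (Vbar_inv t w) w.

End paths.

(* the event {Y_tau > 0} *)
Definition positive_at (R : realType) (T : Type) (Y : R -> T -> R)
  (tau : T -> R) : set T := [set w | 0 < Y (tau w) w].

(* The holding times e_0, e_1, ... of Y at 0, one for each visit, in the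
   Mittag-Leffler sense: what is prescribed is their law conditionally on
   {Y_{e_i} > 0}, so "i.i.d." is understood under the same conditioning:
   given that Y_{e_i} > 0 for all i in a finite set J, the e_i, i in J, are
   independent with their respective conditional laws (all equal by ht_law). *)
Record holding_times d (T : measurableType d) (R : realType)
    (P : probability T R) (alpha eta sigma : R) (Y : R -> T -> R)
    (e : nat -> {RV P >-> R})
    (mpos : forall i, measurable (positive_at Y (e i))) : Prop := {
  ht_ge0 : forall i, {ae P, forall w, 0 <= e i w} ;
  ht_positive : forall J : seq nat,
    (0 < P (\bigcap_(i in [set` J]) positive_at Y (e i)))%E ;
  ht_independent : forall (J : seq nat) (A : nat -> set R), uniq J ->
    (forall i, measurable (A i)) ->
    (P (\bigcap_(i in [set` J]) (positive_at Y (e i) `&` e i @^-1` A i)) =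
     P (\bigcap_(i in [set` J]) positive_at Y (e i)) *
     \prod_(i <- J) cond_prob P (mpos i) (e i @^-1` A i))%E ;
  ht_law : forall i (t : R), 0 <= t ->
    cond_prob P (mpos i) [set w | t < e i w] =
    (mittag_leffler alpha (- (sigma / eta) * t `^ alpha))%:E }.

Arguments reflecting_brownian_motion {d T R} P X.
Arguments local_time {d T R} P X L.
Arguments stable_subordinator {d T R} P alpha H.
Arguments holding_times {d T R} P alpha eta sigma Y e mpos.

(* Main.v *)
Require Import Defs.
From HB Require Import structures.
From mathcomp Require Import all_boot all_order all_algebra.
From mathcomp Require Import all_classical all_reals all_analysis.
From mathcomp Require Import measurable_realfun ring lra.

Set Implicit Arguments.
Unset Strict Implicit.
Unset Printing Implicit Defensive.

Import Order.TTheory GRing.Theory Num.Theory.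
Import numFieldNormedType.Exports.

Local Open Scope classical_set_scope.
Local Open Scope ring_scope.

(** The mean of a nonnegative variable is the integral of its survival function,
so the claim is that [f t = E_alpha (- c t^alpha)], with [c = sigma / eta], has
infinite integral over [[0, +oo[]. Only the sign of [f] is used, and it comes
for free: [f t] is the probability of the event that the holding time exceeds
[t].

With the kernels [h_a x = x^(a - 1) / Gamma a] on [x > 0], which satisfy
[h_a * h_b = h_(a + b)] ([convol_frac_kernel], the Beta integral), the
Mittag-Leffler series reads [f = \sum_k (- c)^k h_(alpha k + 1)]. Hence
[f + c (h_alpha * f) = h_1], and, after one more integration,
[h_1 * f + c (h_(alpha + 1) * f) = h_2] ([mittag_leffler_volterra]). The
integrated equation is the useful one: all its kernels have index at least 1,
so they are bounded on bounded intervals and every Gamma integral in sight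
converges at 0.

If [f] had a finite integral [m], then [h_1 * f] would be at most a constant
times [m] and [(h_(alpha + 1) * f) t] at most a constant times [m t^alpha],
while [h_2 t] is a constant times [t]. As [alpha < 1] this fails for large [t]
([not_le_sublinear]).

To keep all interchanges of sums and integrals within nonnegative functions,
[f] is written [A - B], where [A] and [B] collect the absolute values of the
terms of even and of odd index; they satisfy
[h_1 * A = h_2 + c (h_(alpha + 1) * B)] and
[h_1 * B = c (h_(alpha + 1) * A)]. *)

(** * Affine change of variables *)

Section affine_substitution.
Context {R : realType}.
Local Notation mu := (@lebesgue_measure R).
Local Open Scope ereal_scope.

(** The image of Lebesgue measure under [x |-> r x + b], scaled by [r], agrees
with Lebesgue measure on half-open intervals, hence everywhere. *)
Lemma ge0_integral_affine (r b : R) (f : R -> \bar R) : (0 < r)%R ->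
  measurable_fun setT f -> (forall x, 0 <= f x) ->
  \int[mu]_x f x = r%:E * \int[mu]_x f (r * x + b)%R.
Proof.
move=> r0 mf f0.
pose g (x : measurableTypeR R) : measurableTypeR R := (r * x + b)%R.
have mg : measurable_fun setT g.
  by apply: measurable_funD => //; exact: measurable_funM.
(* a pushforward is a measure only given [mg], hence the abstraction over it *)
pose image_measure : {measure set (measurableTypeR R) -> \bar R} :=
  mscale (NngNum (ltW r0)) (pushforward mu g).
pose m := image_measure mg.
have mE (A : set (measurableTypeR R)) : measurable A -> mu A = m A.
  apply: lebesgue_measure_unique => //= _ [[a c]] _ <-.
  rewrite /m/image_measure /mscale/= /pushforward/=.
  have -> : g @^-1` `]a, c]%classic =
      `]((a - b) / r)%R, ((c - b) / r)%R]%classic.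
    apply/seteqP; split => x /=; rewrite !in_itv/= /g.
      by rewrite ltr_pdivrMr// ler_pdivlMr// ltrBlDr lerBrDr mulrC.
    by rewrite ltr_pdivrMr// ler_pdivlMr// ltrBlDr lerBrDr mulrC.
  rewrite !lebesgue_measure_itv/= !lte_fin ltr_pM2r ?invr_gt0// ltrD2r.
  case: ifPn => _; last by rewrite mule0.
  rewrite -!EFinD -EFinM; congr EFin.
  by field; rewrite gt_eqF.
rewrite (eq_measure_integral m) => [|A mA _]; last exact: mE.
rewrite /m/image_measure ge0_integral_mscale//= ge0_integral_pushforward//.
Qed.

Lemma ge0_integral_shift (s : R) (f : R -> \bar R) :
  measurable_fun setT f -> (forall x, 0 <= f x) ->
  \int[mu]_t f (t - s)%R = \int[mu]_t f t.
Proof.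
move=> mf f0; rewrite [RHS](@ge0_integral_affine 1%R (- s)%R)// mul1e.
by under [RHS]eq_integral do rewrite mul1r.
Qed.

End affine_substitution.

(** * The Gamma integral *)

Section gamma_integral.
Context {R : realType}.
Local Notation mu := (@lebesgue_measure R).

(** The exponent is shifted so that indices add up under convolution. *)
Definition pos_powR (a x : R) : R := if 0 < x then x `^ (a - 1) else 0.

Lemma pos_powR_ge0 a x : 0 <= pos_powR a x.
Proof. by rewrite /pos_powR; case: ifP => // _; exact: powR_ge0. Qed.

Lemma measurable_pos_powR a : measurable_fun setT (pos_powR a).
Proof.
by apply: measurable_fun_ifT => //; exact: measurable_fun_ltr.
Qed.

Lemma pos_powRM a t x : 0 < t ->
  pos_powR a (t * x) = t `^ (a - 1) * pos_powR a x.
Proof.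
move=> t0; rewrite /pos_powR pmulr_rgt0//.
case: ifPn => [x0|]; last by rewrite mulr0.
by rewrite powRM// ltW.
Qed.

Lemma measurable_pos_powR_expR a :
  measurable_fun setT (fun x : R => pos_powR a x * expR (- x)).
Proof.
apply: measurable_funM; first exact: measurable_pos_powR.
by apply: measurableT_comp => //; exact: measurable_funN.
Qed.

Local Open Scope ereal_scope.

(** The Gamma integral as an extended real, for use with Tonelli's theorem
before its finiteness is known. *)
Definition eGamma (a : R) : \bar R :=
  \int[mu]_x (pos_powR a x * expR (- x))%:E.

Lemma eGamma_ge0 a : 0 <= eGamma a.
Proof.
by apply: integral_ge0 => x _; rewrite lee_fin mulr_ge0 ?pos_powR_ge0 ?expR_ge0.
Qed.

Lemma fine_eGamma a : fine (eGamma a) = Gamma a.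
Proof.
rewrite /Gamma /Rintegral integral_mkcond; congr fine.
apply: eq_integral => x _; rewrite patchE /pos_powR; case: ifPn => x0.
  by rewrite mem_set//= in_itv/= x0.
by rewrite memNset ?mul0r//= in_itv/= andbT; exact/negP.
Qed.

(** From [y <= exp y] at [y = x / (2 (p + 1))], raised to the power [p]; the
factor [p + 1] keeps the denominator positive at [p = 0]. *)
Lemma powR_le_expR (p x : R) : (0 <= p)%R -> (0 < x)%R ->
  (x `^ p <= (2 * (p + 1)) `^ p * expR (x / 2))%R.
Proof.
move=> p0 x0; have q0 : (0 < 2 * (p + 1))%R by lra.
have xq : (x <= 2 * (p + 1) * expR (x / (2 * (p + 1))))%R.
  rewrite mulrC -ler_pdivrMr//; apply: le_trans (expR_ge1Dx _); lra.
apply: (@le_trans _ _ ((2 * (p + 1) * expR (x / (2 * (p + 1)))) `^ p)%R).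
  apply: ge0_ler_powR => //; rewrite nnegrE; first exact: ltW.
  by rewrite mulr_ge0 ?expR_ge0// ltW.
rewrite powRM ?expR_ge0//; last exact: ltW.
rewrite ler_wpM2l ?powR_ge0// -expRM ler_expR.
rewrite -mulrA ler_pM2l// ler_pdivrMl// -mulrA.
suff: (p * 2 * 2^-1 <= p + 1)%R by lra.
lra.
Qed.

(** The bound on powers leaves [exp (- x / 2)], a multiple of the density of an
exponential law of rate [1 / 2]. *)
Lemma eGamma_lty a : (1 <= a)%R -> eGamma a < +oo.
Proof.
move=> a1; pose C := (2 * ((2 * (a - 1 + 1)) `^ (a - 1)))%R.
apply: (@le_lt_trans _ _ (\int[mu]_x (C%:E * (exponential_pdf 2^-1 x)%:E))).
  apply: ge0_le_integral => //.
  - by move=> x _; rewrite lee_fin mulr_ge0 ?pos_powR_ge0 ?expR_ge0.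
  - apply/measurable_EFinP; exact: measurable_pos_powR_expR.
  - apply/measurable_EFinP; apply: measurable_funM => //.
    exact: measurable_exponential_pdf.
  move=> x _; rewrite -EFinM lee_fin /pos_powR; case: ifPn => x0; last first.
    by rewrite mul0r mulr_ge0 ?exponential_pdf_ge0// mulr_ge0 ?powR_ge0.
  rewrite exponential_pdfE; last exact: ltW.
  rewrite [leRHS](_ : _ = (2 * (a - 1 + 1)) `^ (a - 1) * expR (- 2^-1 * x))%R;
    last by rewrite /C; field.
  rewrite -ler_pdivlMr ?expR_gt0//.
  apply: le_trans (powR_le_expR _ x0) _; first by rewrite subr_ge0.
  rewrite -mulrA ler_wpM2l ?powR_ge0// -expRN -expRD ler_expR; lra.
rewrite ge0_integralZl_EFin//.
- by rewrite integral_exponential_pdf// mule1 ltry.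
- by move=> x _; rewrite lee_fin exponential_pdf_ge0.
- apply/measurable_EFinP; exact: measurable_exponential_pdf.
- by rewrite mulr_ge0 ?powR_ge0.
Qed.

Lemma eGammaE a : (1 <= a)%R -> eGamma a = (Gamma a)%:E.
Proof.
move=> a1; rewrite -fine_eGamma fineK// ge0_fin_numE ?eGamma_lty//.
exact: eGamma_ge0.
Qed.

(** Keeping only [[N, N + 1]] in the Gamma integral. As [N] is free, Gamma grows
faster than any geometric sequence, which is all that the convergence of the
Mittag-Leffler series needs. *)
Lemma Gamma_lower_bound (a N : R) : (1 <= a)%R -> (0 < N)%R ->
  (N `^ (a - 1) * expR (- (N + 1)) <= Gamma a)%R.
Proof.
move=> a1 N0; rewrite -lee_fin -eGammaE//.
set c := (X in X%:E <= _).
apply: (@le_trans _ _ (\int[mu]_(x in `[N, (N + 1)%R]) (cst c%:E x))).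
  rewrite integral_cst//= lebesgue_measure_itv/= lte_fin ltrDl ltr01.
  by rewrite -EFinD addrAC subrr add0r mule1.
apply: (@le_trans _ _
  (\int[mu]_(x in `[N, (N + 1)%R]) (pos_powR a x * expR (- x))%:E)).
  apply: ge0_le_integral => //.
  - by move=> x _; rewrite lee_fin mulr_ge0 ?powR_ge0 ?expR_ge0.
  - apply/measurable_EFinP; apply: measurable_funTS.
    exact: measurable_pos_powR_expR.
  move=> x /=; rewrite in_itv/= => /andP[Nx xN].
  rewrite lee_fin /pos_powR (lt_le_trans N0 Nx).
  rewrite ler_pM ?powR_ge0 ?expR_ge0//.
    apply: ge0_ler_powR => //; rewrite ?subr_ge0// nnegrE ltW//.
    exact: lt_le_trans Nx.
  by rewrite ler_expR lerN2.
apply: ge0_subset_integral => //.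
- apply/measurable_EFinP; exact: measurable_pos_powR_expR.
- by move=> x _; rewrite lee_fin mulr_ge0 ?pos_powR_ge0 ?expR_ge0.
Qed.

Lemma Gamma_gt0 (a : R) : (1 <= a)%R -> (0 < Gamma a)%R.
Proof.
move=> a1; apply: lt_le_trans (Gamma_lower_bound a1 ltr01).
by rewrite powR1 mul1r expR_gt0.
Qed.

End gamma_integral.

(** * Convolution of fractional kernels *)

Section convolution.
Context {R : realType}.
Local Notation mu := (@lebesgue_measure R).

(** The kernel of the Riemann-Liouville fractional integral of order [a]. *)
Definition frac_kernel (a x : R) : R := pos_powR a x / Gamma a.

Lemma frac_kernel_ge0 a x : 1 <= a -> 0 <= frac_kernel a x.
Proof. by move=> a1; rewrite divr_ge0 ?pos_powR_ge0// ltW// Gamma_gt0. Qed.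

Lemma measurable_frac_kernel a : measurable_fun setT (frac_kernel a).
Proof. by apply: measurable_funM => //; exact: measurable_pos_powR. Qed.

Local Open Scope ereal_scope.

Definition convol (k : R -> R) (g : R -> \bar R) (t : R) : \bar R :=
  \int[mu]_s ((k (t - s)%R)%:E * g s).

Lemma measurable_reflection (k : R -> R) (t : R) : measurable_fun setT k ->
  measurable_fun setT (fun s : R => k (t - s)%R).
Proof.
move=> mk; apply: (measurableT_comp mk).
exact: (measurable_funB (@measurable_cst _ _ R R _ t) (@measurable_id _ R _)).
Qed.

Lemma measurable_convol_integrand (k : R -> R) (g : R -> \bar R) (t : R) :
  measurable_fun setT k -> measurable_fun setT g ->
  measurable_fun setT (fun s : R => (k (t - s)%R)%:E * g s).
Proof.
move=> mk mg; apply: emeasurable_funM => //.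
by apply/measurable_EFinP; exact: measurable_reflection.
Qed.

Lemma convol_pos_powR_ge0 (a b t : R) :
  0 <= convol (pos_powR a) (EFin \o pos_powR b) t.
Proof.
by apply: integral_ge0 => s _; rewrite -EFinM lee_fin mulr_ge0 ?pos_powR_ge0.
Qed.

(** The substitution [s = t u] reduces the convolution at [t] to the one at [1],
which is the Beta integral [B(a, b)]. *)
Lemma convol_pos_powR_scaling (a b t : R) :
  convol (pos_powR a) (EFin \o pos_powR b) t =
  (pos_powR (a + b) t)%:E * convol (pos_powR a) (EFin \o pos_powR b) 1%R.
Proof.
have [t0|t0] := ltP 0%R t; last first.
  rewrite [pos_powR (a + b) t]/pos_powR ltNge t0/= mul0e.
  rewrite /convol integral0_eq// => s _.
  rewrite /= /pos_powR; case: ifPn => ts; last by rewrite mul0e.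
  by rewrite ifF ?mule0//; apply/negbTE; rewrite -leNgt; lra.
pose f u (s : R) := (pos_powR a (u - s))%:E * (EFin \o pos_powR b) s.
have mf u : measurable_fun setT (f u).
  apply: measurable_convol_integrand; first exact: measurable_pos_powR.
  by apply/measurable_EFinP; exact: measurable_pos_powR.
have f0 u s : 0 <= f u s.
  by rewrite /f -EFinM lee_fin mulr_ge0 ?pos_powR_ge0.
rewrite /convol [LHS](ge0_integral_affine 0%R t0 (mf t) (f0 t)) /f.
under eq_integral => x _.
  rewrite addr0 -EFinM/= (_ : t - t * x = t * (1 - x))%R; last by ring.
  rewrite !pos_powRM// mulrACA EFinM [X in _ * X]EFinM.
  over.
rewrite ge0_integralZl_EFin; last 4 first.
- exact: measurableT.
- by move=> x _; exact: (f0 1%R x).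
- exact: (mf 1%R).
- by rewrite mulr_ge0 ?powR_ge0.
rewrite muleA -EFinM; congr (_%:E * _).
rewrite /pos_powR t0 -powRD; last by rewrite (gt_eqF t0) implybT.
rewrite -[X in (X * _)%R]powRr1 ?(ltW t0)// -powRD; last first.
  by rewrite (gt_eqF t0) implybT.
by congr (_ `^ _)%R; ring.
Qed.

(** [Gamma a * Gamma b = Gamma (a + b) * B(a, b)]: the left-hand side is the
integral over the plane of [g a (t - s) * g b s], where [g c] is the integrand
of [eGamma c]; integrating in [s] first leaves [exp (- t)] times the convolution
of the two powers at [t]. *)
Lemma eGamma_mul (a b : R) :
  eGamma a * eGamma b =
  eGamma (a + b) * convol (pos_powR a) (EFin \o pos_powR b) 1%R.
Proof.
pose g c (x : R) : R := (pos_powR c x * expR (- x))%R.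
have g0 c x : (0 <= g c x)%R by rewrite mulr_ge0 ?pos_powR_ge0 ?expR_ge0.
have mg c : measurable_fun setT (g c) by exact: measurable_pos_powR_expR.
have meg c : measurable_fun setT (EFin \o g c) by exact/measurable_EFinP.
pose f (z : R * R) : \bar R := (g a (z.1 - z.2) * g b z.2)%:E.
have mf : measurable_fun setT f.
  apply/measurable_EFinP; apply: measurable_funM.
    apply: (measurableT_comp (mg a)).
    by apply: measurable_funB.
  exact: (measurableT_comp (mg b)).
have f0 z : 0 <= f z by rewrite lee_fin mulr_ge0 ?g0.
transitivity (\int[mu]_s \int[mu]_t f (t, s)).
  rewrite [eGamma b]/eGamma -ge0_integralZl//; last 3 first.
  - exact: meg.
  - by move=> x _; rewrite lee_fin; exact: g0.
  - exact: eGamma_ge0.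
  apply: eq_integral => s _; rewrite /f/=.
  under [RHS]eq_integral do rewrite EFinM muleC.
  rewrite ge0_integralZl//; last 3 first.
  - apply: (measurableT_comp (meg a)); exact: measurable_funB.
  - by move=> x _; rewrite lee_fin; exact: g0.
  - by rewrite lee_fin; exact: g0.
  have eg0 x : 0 <= (EFin \o g a) x by rewrite lee_fin; exact: g0.
  by rewrite (ge0_integral_shift s (meg a) eg0) muleC.
transitivity (\int[mu]_t \int[mu]_s f (t, s)).
  apply/esym.
  exact: (@fubini_tonelli _ _ (measurableTypeR R) (measurableTypeR R) R
    mu mu f).
transitivity (\int[mu]_t ((g (a + b)%R t)%:E *
    convol (pos_powR a) (EFin \o pos_powR b) 1%R)).
  apply: eq_integral => t _.
  rewrite [in RHS]/g mulrC EFinM -muleA -convol_pos_powR_scaling.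
  rewrite /convol -ge0_integralZl//; last 2 first.
  - apply: measurable_convol_integrand; first exact: measurable_pos_powR.
    by apply/measurable_EFinP; exact: measurable_pos_powR.
  - by move=> x _; rewrite -EFinM lee_fin mulr_ge0 ?pos_powR_ge0.
  apply: eq_integral => s _; rewrite /f /g/= -!EFinM; congr EFin.
  rewrite mulrACA -expRD mulrC; congr (expR _ * _)%R; ring.
rewrite ge0_integralZr//.
- exact: meg.
- by move=> x _; rewrite lee_fin; exact: g0.
- exact: convol_pos_powR_ge0.
Qed.

Lemma convol_frac_kernel (a b t : R) : (1 <= a)%R -> (1 <= b)%R ->
  convol (frac_kernel a) (EFin \o frac_kernel b) t = (frac_kernel (a + b) t)%:E.
Proof.
move=> a1 b1; have ab1 : (1 <= a + b)%R by lra.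
have /= := eGamma_mul a b; rewrite !eGammaE//.
have /= := convol_pos_powR_scaling a b t.
have := convol_pos_powR_ge0 a b 1%R.
move: (convol _ _ 1%R) => B B0 scal beta.
rewrite /frac_kernel.
move: (Gamma_gt0 a1) (Gamma_gt0 b1) (Gamma_gt0 ab1) beta.
move: (Gamma a) (Gamma b) (Gamma (a + b)) => ga gb gab Ga Gb Gab beta.
have BE : B = (ga * gb / gab)%:E.
  case: B B0 beta {scal} => [r _ /= [] rE|_|//].
    by congr EFin; rewrite rE mulrAC divff ?mul1r// gt_eqF.
  (* an infinite Beta integral would make the right-hand side infinite *)
  by rewrite gt0_muley// lte_fin.
rewrite {beta}BE {B B0} in scal.
transitivity ((ga^-1 * gb^-1)%:E *
    convol (pos_powR a) (EFin \o pos_powR b) t).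
  rewrite /convol -ge0_integralZl//; last 3 first.
  - apply: measurable_convol_integrand; first exact: measurable_pos_powR.
    by apply/measurable_EFinP; exact: measurable_pos_powR.
  - by move=> x _; rewrite -EFinM lee_fin mulr_ge0 ?pos_powR_ge0.
  - by rewrite lee_fin mulr_ge0// invr_ge0 ltW.
  apply: eq_integral => s _; rewrite /= -!EFinM; congr EFin.
  by rewrite mulrACA [LHS]mulrC.
rewrite scal -!EFinM; congr EFin.
by field; rewrite !gt_eqF.
Qed.

Lemma frac_kernel_nonpos (a x : R) : (x <= 0)%R -> frac_kernel a x = 0%R.
Proof. by move=> x0; rewrite /frac_kernel /pos_powR ltNge x0/= mul0r. Qed.

Lemma frac_kernel_le (a x t : R) : (1 <= a)%R -> (0 < t)%R -> (x <= t)%R ->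
  (frac_kernel a x <= t `^ (a - 1) / Gamma a)%R.
Proof.
move=> a1 t0 xt; rewrite /frac_kernel ler_pM2r ?invr_gt0 ?Gamma_gt0//.
rewrite /pos_powR; case: ifPn => x0; last exact: powR_ge0.
by apply: ge0_ler_powR => //; rewrite ?subr_ge0// nnegrE ltW.
Qed.

(** Where [g] is nonzero the kernel is evaluated left of [t], where it is at
most its value at [t]. *)
Lemma convol_frac_kernel_le (a t : R) (g : R -> \bar R) :
  (1 <= a)%R -> (0 < t)%R -> measurable_fun setT g ->
  (forall s, 0 <= g s) -> (forall s, (s <= 0)%R -> g s = 0) ->
  convol (frac_kernel a) g t <= (t `^ (a - 1) / Gamma a)%:E * \int[mu]_s g s.
Proof.
move=> a1 t0 mg g0 gneg.
rewrite -ge0_integralZl//; last first.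
  by rewrite lee_fin divr_ge0 ?powR_ge0// ltW// Gamma_gt0.
apply: ge0_le_integral => //.
- by move=> s _; rewrite mule_ge0// lee_fin frac_kernel_ge0.
- by apply: measurable_convol_integrand => //; exact: measurable_frac_kernel.
- exact: measurable_funeM.
move=> s _; have [s0|s0] := leP s 0%R; first by rewrite gneg// !mule0.
by rewrite lee_wpmul2r// lee_fin frac_kernel_le//; lra.
Qed.

End convolution.

(** * Series of fractional kernels *)

Section frac_series.
Context {R : realType}.
Local Open Scope ereal_scope.

(** The coefficients are separated from the kernels so that the even and the odd
parts of the Mittag-Leffler series, and their fractional integrals, are all
instances. *)
Definition frac_series (alpha : R) (u : nat -> R) (b x : R) : \bar R :=
  \sum_(k <oo) (u k * frac_kernel (alpha * k%:R + b) x)%:E.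

Section fixed_order.
Context (alpha : R) (alpha0 : (0 < alpha)%R).

Let index_ge1 (b : R) (k : nat) : (1 <= b)%R -> (1 <= alpha * k%:R + b)%R.
Proof. by move=> b1; rewrite -[leLHS]add0r lerD// mulr_ge0// ltW. Qed.

Lemma frac_series_term_ge0 (u : nat -> R) (b x : R) (k : nat) :
  (forall k, 0 <= u k)%R -> (1 <= b)%R ->
  0 <= (u k * frac_kernel (alpha * k%:R + b) x)%:E.
Proof.
by move=> u0 b1; rewrite lee_fin mulr_ge0// frac_kernel_ge0// index_ge1.
Qed.

Lemma measurable_frac_series (u : nat -> R) (b : R) :
  (forall k, 0 <= u k)%R -> (1 <= b)%R ->
  measurable_fun setT (frac_series alpha u b).
Proof.
move=> u0 b1; apply: ge0_emeasurable_sum.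
  by move=> k x _ _; exact: frac_series_term_ge0.
move=> k _; apply/measurable_EFinP; apply: measurable_funM => //.
exact: measurable_frac_kernel.
Qed.

Lemma frac_series_ge0 (u : nat -> R) (b x : R) :
  (forall k, 0 <= u k)%R -> (1 <= b)%R -> 0 <= frac_series alpha u b x.
Proof.
by move=> u0 b1; apply: nneseries_ge0 => k _ _; exact: frac_series_term_ge0.
Qed.

Lemma frac_series_nonpos (u : nat -> R) (b x : R) : (x <= 0)%R ->
  frac_series alpha u b x = 0.
Proof.
by move=> x0; apply: eseries0 => k _ _; rewrite frac_kernel_nonpos// mulr0.
Qed.

(** Gamma is bounded below at a level [N] proportional to [x], chosen so that
[c (x / N)^alpha = 1 / 2]: the terms are then dominated by [C / 2^k]. *)
Lemma frac_series_lty (c : R) (u : nat -> R) (b x : R) : (0 < c)%R ->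
  (forall k, 0 <= u k <= c ^+ k)%R -> (1 <= b)%R ->
  frac_series alpha u b x < +oo.
Proof.
move=> c0 uc b1; have [x0|x0] := leP x 0%R.
  by rewrite frac_series_nonpos.
have u0 k : (0 <= u k)%R by have /andP[] := uc k.
pose N := (x * (2 * c) `^ alpha^-1)%R.
have c20 : (0 < 2 * c)%R by rewrite mulr_gt0.
have N0 : (0 < N)%R by rewrite mulr_gt0// powR_gt0.
pose C := ((x / N) `^ (b - 1) / expR (- (N + 1)))%R.
have C0 : (0 <= C)%R by rewrite divr_ge0 ?powR_ge0 ?expR_ge0.
have xN : ((x / N) `^ alpha = (2 * c)^-1)%R.
  rewrite /N invfM mulrA divff ?gt_eqF// mul1r.
  by rewrite -powRN -powRrM mulNr mulVf ?gt_eqF// powR_inv1// ltW.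
have bound k : (u k * frac_kernel (alpha * k%:R + b) x <=
    geometric C 2^-1 k)%R.
  apply: (@le_trans _ _ (c ^+ k * (C * (2 * c)^-1 ^+ k))%R); last first.
    by rewrite /geometric/= mulrCA -exprMn invfM mulrCA divff ?mulr1// gt_eqF.
  apply: ler_pM => //; first by rewrite frac_kernel_ge0 ?index_ge1.
    by have /andP[] := uc k.
  apply: le_trans (frac_kernel_le (index_ge1 k b1) x0 (lexx x)) _.
  rewrite ler_pdivrMr ?Gamma_gt0 ?index_ge1//.
  apply: le_trans (ler_wpM2l _ (Gamma_lower_bound (index_ge1 k b1) N0)).
    2: by rewrite mulr_ge0// exprn_ge0// invr_ge0 ltW.
  set p := (alpha * k%:R + b - 1)%R.
  have -> : (C * (2 * c)^-1 ^+ k = (x / N) `^ p / expR (- (N + 1)))%R.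
    rewrite -xN -powR_mulrn ?powR_ge0// -powRrM mulrAC -powRD; last first.
      by rewrite [(_ / _ == 0)%R]gt_eqF ?divr_gt0// implybT.
    by congr (_ `^ _ / _)%R; rewrite /p; ring.
  have eN0 : (expR (- (N + 1)) != 0)%R by rewrite gt_eqF// expR_gt0.
  rewrite mulrACA -powRM ?(ltW N0) ?divr_ge0 ?(ltW N0) ?(ltW x0)//.
  rewrite mulfVK ?(gt_eqF N0)//.
  by rewrite mulVf// mulr1.
apply: (@le_lt_trans _ _ (C * (1 - 2^-1)^-1)%:E); last exact: ltry.
apply: lime_le.
  by apply: is_cvg_nneseries => k _ _; exact: frac_series_term_ge0.
apply: nearW => n; rewrite sumEFin lee_fin.
apply: le_trans (@geometric_le_lim _ n C 2^-1 _ _ _) => //.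
  by rewrite /series/=; apply: ler_sum => k _; exact: bound.
by rewrite ger0_norm// invf_lt1// ltr1n.
Qed.

Lemma convol_frac_series (u : nat -> R) (a b t : R) :
  (forall k, 0 <= u k)%R -> (1 <= a)%R -> (1 <= b)%R ->
  convol (frac_kernel a) (frac_series alpha u b) t =
  frac_series alpha u (a + b) t.
Proof.
move=> u0 a1 b1; rewrite /convol /frac_series.
under eq_integral => s _.
  rewrite -nneseriesZl; last by move=> k _; exact: frac_series_term_ge0.
  over.
rewrite integral_nneseries//; last 2 first.
- move=> k; apply: measurable_convol_integrand.
    exact: measurable_frac_kernel.
  apply/measurable_EFinP; apply: measurable_funM => //.
  exact: measurable_frac_kernel.
- move=> k s _; rewrite mule_ge0 ?frac_series_term_ge0//.
  by rewrite lee_fin frac_kernel_ge0.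
apply: eq_eseriesr => k _.
rewrite EFinM addrCA -convol_frac_kernel ?index_ge1// /convol -ge0_integralZl//.
- by apply: eq_integral => s _; rewrite EFinM muleCA.
- apply: measurable_convol_integrand; first exact: measurable_frac_kernel.
  by apply/measurable_EFinP; exact: measurable_frac_kernel.
- by move=> s _; rewrite -EFinM lee_fin mulr_ge0 ?frac_kernel_ge0 ?index_ge1.
- by rewrite lee_fin.
Qed.

(** The remaining terms form a series whose first index has moved up by
[alpha]. *)
Lemma frac_series_recl (c : R) (u v : nat -> R) (b x : R) :
  (forall k, 0 <= u k)%R -> (forall k, 0 <= v k)%R -> (1 <= b)%R ->
  (forall k, v k.+1 = c * u k)%R ->
  frac_series alpha v b x =
  (v 0%N * frac_kernel b x)%:E + c%:E * frac_series alpha u (alpha + b) x.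
Proof.
move=> u0 v0 b1 vu.
have v_ge0 k := frac_series_term_ge0 x k v0 b1.
have recl := nneseries_recl (P := xpredT) (fun k _ => v_ge0 k) isT.
apply: (etrans recl); rewrite mulr0 add0r; congr (_ + _).
apply: (etrans (esym (nneseries_addn 1 v_ge0))); rewrite /frac_series.
rewrite -nneseriesZl; last first.
  move=> k _; apply: frac_series_term_ge0 => //.
  by rewrite -[leLHS]add0r lerD// ltW.
apply: eq_eseriesr => k _; rewrite addn1 vu -EFinM -mulrA.
by congr ((_ * (_ * frac_kernel _ _))%:E); rewrite -natr1; ring.
Qed.

End fixed_order.
End frac_series.

(** * The integral of the Mittag-Leffler survival function *)

Section mittag_leffler_tail.
Context {R : realType}.
Local Notation mu := (@lebesgue_measure R).

Lemma nneseries_fin_cvg (u : nat -> R) : (forall k, 0 <= u k) ->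
  (\sum_(k <oo) (u k)%:E < +oo)%E ->
  series u @ \oo --> fine (\sum_(k <oo) (u k)%:E)%E.
Proof.
move=> u0 uoo.
rewrite (_ : series u = fine \o (fun n => \sum_(0 <= k < n) (u k)%:E)%E).
  apply: fine_cvg; rewrite fineK.
    by apply: is_cvg_nneseries => k _ _; rewrite lee_fin.
  by rewrite ge0_fin_numE// nneseries_ge0// => k _ _; rewrite lee_fin.
by apply/funext => n; rewrite /= sumEFin.
Qed.

Lemma not_le_sublinear (alpha p q : R) : 0 < alpha -> alpha < 1 ->
  0 <= p -> 0 <= q -> ~ (forall t, 0 < t -> t <= p + q * t `^ alpha).
Proof.
move=> alpha0 alpha1 p0 q0 le_t.
have b0 : 0 < 1 - alpha by rewrite subr_gt0.
have D1 : 1 <= p + q + 1 by rewrite lerDr addr_ge0.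
(* chosen so that [t = t^alpha (p + q + 1)] *)
pose t := (p + q + 1) `^ (1 - alpha)^-1.
have t1 : 1 <= t.
  by rewrite -[leLHS](powRr0 (p + q + 1)) ler_powR// invr_ge0 ltW.
have t0 : 0 < t by exact: lt_le_trans t1.
have ta1 : 1 <= t `^ alpha by rewrite -[leLHS](powRr0 t) ler_powR// ltW.
have tE : t = t `^ alpha * (p + q + 1).
  have -> : p + q + 1 = t `^ (1 - alpha).
    by rewrite /t -powRrM mulVf ?gt_eqF// powRr1// addr_ge0// addr_ge0.
  rewrite -powRD; last by rewrite (gt_eqF t0) implybT.
  by rewrite addrC subrK powRr1// ltW.
have := le_t t t0; rewrite [leLHS]tE.
have : p <= t `^ alpha * p by rewrite ler_peMl.
lra.
Qed.

Definition even_coef (c : R) (k : nat) : R := if odd k then 0 else c ^+ k.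

Definition odd_coef (c : R) (k : nat) : R := if odd k then c ^+ k else 0.

(** Cutting off at [x <= 0] makes convolutions over the whole line run over
[[0, t]] only. *)
Definition ml_survival (alpha c x : R) : R :=
  if 0 < x then mittag_leffler alpha (- c * x `^ alpha) else 0.

Section even_odd_parts.
Context (alpha c : R) (alpha0 : 0 < alpha) (c0 : 0 < c).

Local Notation ev := (even_coef c).
Local Notation od := (odd_coef c).
Local Notation A b := (frac_series alpha ev b).
Local Notation B b := (frac_series alpha od b).
Local Notation F := (ml_survival alpha c).

Let ev0 k : 0 <= ev k.
Proof. by rewrite /even_coef; case: ifP => // _; rewrite exprn_ge0// ltW. Qed.
Let od0 k : 0 <= od k.
Proof. by rewrite /odd_coef; case: ifP => // _; rewrite exprn_ge0// ltW. Qed.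
Let ev_le k : 0 <= ev k <= c ^+ k.
Proof.
by rewrite ev0/= /even_coef; case: ifP => // _; rewrite exprn_ge0// ltW.
Qed.
Let od_le k : 0 <= od k <= c ^+ k.
Proof.
by rewrite od0/= /odd_coef; case: ifP => // _; rewrite exprn_ge0// ltW.
Qed.
Let evS k : ev k.+1 = c * od k.
Proof.
by rewrite /even_coef /odd_coef/=; case: (odd k); rewrite ?mulr0 -?exprS.
Qed.
Let odS k : od k.+1 = c * ev k.
Proof.
by rewrite /even_coef /odd_coef/=; case: (odd k); rewrite ?mulr0 -?exprS.
Qed.

Let A_fin (b x : R) : 1 <= b -> A b x \is a fin_num.
Proof.
by move=> b1; rewrite ge0_fin_numE ?frac_series_ge0// (frac_series_lty _ _ c0).
Qed.
Let B_fin (b x : R) : 1 <= b -> B b x \is a fin_num.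
Proof.
by move=> b1; rewrite ge0_fin_numE ?frac_series_ge0// (frac_series_lty _ _ c0).
Qed.

Lemma mittag_leffler_even_odd (x : R) : 0 < x ->
  mittag_leffler alpha (- c * x `^ alpha) = fine (A 1 x) - fine (B 1 x).
Proof.
move=> x0; rewrite /mittag_leffler.
have cvg_part u : (forall k, 0 <= u k <= c ^+ k) ->
    series (fun k => u k * frac_kernel (alpha * k%:R + 1) x) @ \oo -->
    fine (frac_series alpha u 1 x).
  move=> uc; have u0 k : 0 <= u k by have /andP[] := uc k.
  apply: nneseries_fin_cvg.
    by move=> k; rewrite -lee_fin frac_series_term_ge0.
  exact: (frac_series_lty _ _ c0).
rewrite (_ : series _ =
    series (fun k => ev k * frac_kernel (alpha * k%:R + 1) x) -
    series (fun k => od k * frac_kernel (alpha * k%:R + 1) x)).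
  by apply/cvg_lim => //; apply: cvgB; exact: cvg_part.
apply/funext => n; rewrite /series/= fctE -sumrB; apply: eq_bigr => k _.
rewrite -mulrBl /frac_kernel /pos_powR x0 addrK mulrA; congr (_ / _).
rewrite powRrM powR_mulrn ?powR_ge0// exprMn; congr (_ * _).
rewrite /even_coef /odd_coef -[in LHS]mulN1r exprMn -signr_odd.
by case: (odd k); rewrite ?expr1 ?expr0 ?sub0r ?subr0 ?mulN1r ?mul1r.
Qed.

Local Open Scope ereal_scope.

Let F_split (x : R) : A 1 x = (F x)%:E + B 1 x.
Proof.
rewrite /ml_survival; case: ifPn => x0; last first.
  by rewrite !frac_series_nonpos ?adde0// leNgt.
rewrite mittag_leffler_even_odd// EFinB !fineK ?A_fin ?B_fin//.
by rewrite subeK// B_fin.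
Qed.

Let mF : measurable_fun setT (EFin \o F).
Proof.
rewrite (_ : EFin \o F = A 1 \- B 1).
  by apply: emeasurable_funB; exact: measurable_frac_series.
by apply/funext => x; rewrite /= F_split addeK// B_fin.
Qed.

Context (mittag_leffler_ge0 : forall x : R, (0 <= x)%R ->
  (0 <= mittag_leffler alpha (- c * x `^ alpha))%R).

Let F0 x : 0 <= (F x)%:E.
Proof.
rewrite lee_fin /ml_survival; case: ifPn => // x0.
by rewrite mittag_leffler_ge0// ltW.
Qed.

Let convol_split a t : (1 <= a)%R ->
  convol (frac_kernel a) (A 1) t =
  convol (frac_kernel a) (EFin \o F) t + convol (frac_kernel a) (B 1) t.
Proof.
move=> a1; rewrite /convol -ge0_integralD//.
- by apply: eq_integral => s _; rewrite F_split ge0_muleDr// frac_series_ge0.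
- by move=> s _; rewrite mule_ge0 ?F0// lee_fin frac_kernel_ge0.
- by apply: measurable_convol_integrand => //; exact: measurable_frac_kernel.
- by move=> s _; rewrite mule_ge0 ?frac_series_ge0// lee_fin frac_kernel_ge0.
- apply: measurable_convol_integrand; first exact: measurable_frac_kernel.
  exact: measurable_frac_series.
Qed.

(** Subtracting the equations for [A] and [B]; both sides contain
[c (h_(1 + alpha) * B)], which is finite and cancels. *)
Lemma mittag_leffler_volterra (t : R) :
  convol (frac_kernel 1) (EFin \o F) t +
    c%:E * convol (frac_kernel (1 + alpha)) (EFin \o F) t =
  (frac_kernel (1 + 1) t)%:E.
Proof.
have a1 : (1 <= 1 + alpha)%R by rewrite lerDl ltW.
have a2 : (1 <= 1 + alpha + 1)%R by rewrite (le_trans a1)// lerDl.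
have ind : (alpha + (1 + 1) = 1 + alpha + 1)%R by ring.
have one1 : (1 <= 1 :> R)%R by [].
have two1 : (1 <= 1 + 1 :> R)%R by rewrite lerDl.
have stepA : convol (frac_kernel 1) (A 1) t = (frac_kernel (1 + 1) t)%:E +
    c%:E * convol (frac_kernel (1 + alpha)) (B 1) t.
  rewrite [LHS](convol_frac_series alpha0 t ev0 one1 one1).
  rewrite [X in _ + _ * X](convol_frac_series alpha0 t od0 a1 one1).
  rewrite (frac_series_recl alpha0 t od0 ev0 two1 evS).
  by rewrite ind /even_coef/= expr0 mul1r.
have stepB : convol (frac_kernel 1) (B 1) t =
    c%:E * convol (frac_kernel (1 + alpha)) (A 1) t.
  rewrite [LHS](convol_frac_series alpha0 t od0 one1 one1).
  rewrite [X in _ * X](convol_frac_series alpha0 t ev0 a1 one1).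
  rewrite (frac_series_recl alpha0 t ev0 od0 two1 odS).
  by rewrite ind /odd_coef/= mul0r add0e.
have Bfin : c%:E * convol (frac_kernel (1 + alpha)) (B 1) t \is a fin_num.
  by rewrite convol_frac_series// fin_numM// B_fin.
have CF0 : 0 <= convol (frac_kernel (1 + alpha)) (EFin \o F) t.
  apply: integral_ge0 => s _.
  by rewrite mule_ge0// ?F0// lee_fin frac_kernel_ge0.
have cancel : convol (frac_kernel 1) (EFin \o F) t +
    c%:E * (convol (frac_kernel (1 + alpha)) (EFin \o F) t +
            convol (frac_kernel (1 + alpha)) (B 1) t) =
    (frac_kernel (1 + 1) t)%:E +
    c%:E * convol (frac_kernel (1 + alpha)) (B 1) t.
  rewrite -[RHS]stepA [RHS](convol_split t one1); congr (_ + _).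
  rewrite [RHS]stepB; congr (_ * _); exact/esym/(convol_split t a1).
have CB0 : 0 <= convol (frac_kernel (1 + alpha)) (B 1) t.
  apply: integral_ge0 => s _.
  by rewrite mule_ge0 ?frac_series_ge0// lee_fin frac_kernel_ge0.
rewrite ge0_muleDr// addeA in cancel.
by rewrite -[LHS](addeK _ Bfin) cancel addeK.
Qed.

Let integral_F : \int[mu]_(x in `[0%R, +oo[)
  (mittag_leffler alpha (- c * x `^ alpha))%:E = \int[mu]_x (F x)%:E.
Proof.
have FE x : `]0%R, +oo[%classic x ->
    (mittag_leffler alpha (- c * x `^ alpha))%:E = (F x)%:E.
  by rewrite /= in_itv/= andbT /ml_survival => ->.
(* the two integrands differ at most at [x = 0] *)
rewrite -integral_itv_obnd_cbnd; last first.
  apply: (eq_measurable_fun (EFin \o F)); last exact: measurable_funTS.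
  by move=> x /[!inE] x0; rewrite /= FE.
rewrite integral_mkcond; apply: eq_integral => x _.
rewrite patchE; case: ifPn => [/[!inE] /FE//|].
rewrite notin_setE/= in_itv/= andbT => /negP/negbTE x0.
by rewrite /ml_survival x0.
Qed.

(** A finite integral would bound the left-hand side of the Volterra equation by
a constant plus a multiple of [t^alpha], against a multiple of [t]. *)
Lemma integral_mittag_leffler_infty : (alpha < 1)%R ->
  \int[mu]_(x in `[0%R, +oo[)
    (mittag_leffler alpha (- c * x `^ alpha))%:E = +oo.
Proof.
move=> alpha1; rewrite integral_F; apply/eqP; rewrite eq_le leey/= leNgt.
apply/negP => Foo.
have : \int[mu]_x (F x)%:E \is a fin_num by rewrite ge0_fin_numE// integral_ge0.
have M0 : 0 <= \int[mu]_x (F x)%:E by exact: integral_ge0.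
move=> /fineK; move: (fine _) => m Fm.
have {M0} m0 : (0 <= m)%R by rewrite -lee_fin Fm.
have a1 : (1 <= 1 + alpha)%R by rewrite lerDl ltW.
have a2 : (1 <= 1 + 1 :> R)%R by rewrite lerDl.
have G1 := Gamma_gt0 (lexx (1 : R)%R).
have G2 := Gamma_gt0 a2.
have Ga := Gamma_gt0 a1.
have Fneg s : (s <= 0)%R -> (EFin \o F) s = 0.
  by move=> s0; rewrite /= /ml_survival ltNge s0.
have bound (t : R) : (0 < t)%R ->
    (t / Gamma (1 + 1) <=
     m / Gamma 1 + c * (t `^ alpha / Gamma (1 + alpha) * m))%R.
  move=> t0; have := mittag_leffler_volterra t.
  rewrite [frac_kernel (1 + 1) t]/frac_kernel /pos_powR t0 addrK.
  rewrite powRr1 ?(ltW t0)// => volterra.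
  rewrite -lee_fin -volterra EFinD; apply: leeD.
    apply: le_trans (convol_frac_kernel_le (lexx _) t0 mF F0 Fneg) _.
    by rewrite -Fm -EFinM lee_fin subrr powRr0 div1r mulrC.
  rewrite EFinM lee_wpmul2l ?lee_fin ?(ltW c0)//.
  apply: le_trans (convol_frac_kernel_le a1 t0 mF F0 Fneg) _.
  by rewrite -Fm -EFinM lee_fin addrAC subrr add0r.
apply: (@not_le_sublinear alpha (Gamma (1 + 1) * (m / Gamma 1))%R
  (Gamma (1 + 1) * (c * (m / Gamma (1 + alpha))))%R alpha0 alpha1).
- by rewrite mulr_ge0 ?(ltW G2)// divr_ge0 ?(ltW G1).
- by rewrite mulr_ge0 ?(ltW G2)// mulr_ge0 ?(ltW c0)// divr_ge0 ?(ltW Ga).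
move=> t t0; have := bound t t0; rewrite ler_pdivrMr// => /le_trans; apply.
by rewrite mulrDl lerD// le_eqVlt; apply/orP; left; apply/eqP; ring.
Qed.

End even_odd_parts.
End mittag_leffler_tail.

(** * Mean holding times *)

Section conditional_expectation.
Context d (T : measurableType d) (R : realType) (P : probability T R).

Lemma cond_prob_null (B : set T) (mB : measurable B) (N : set T) :
  measurable N -> P N = 0%E -> cond_prob P mB N = 0%E.
Proof.
move=> mN PN0; rewrite /cond_prob /= /mnormalize /mrestr; case: ifPn => //= _.
rewrite [X in (X * _)%E](_ : _ = 0%E) ?mul0e//.
by apply: subset_measure0 PN0 => //; exact: measurableI.
Qed.

Lemma ae_cond_prob (B : set T) (mB : measurable B) (Q : T -> Prop) :
  {ae P, forall w, Q w} -> {ae cond_prob P mB, forall w, Q w}.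
Proof.
by move=> [N [mN PN0 QN]]; exists N; split => //; exact: cond_prob_null.
Qed.

(** The layer-cake formula, applied to the positive part of [X]. *)
Lemma ae_ge0_expectation_ccdf (X : {RV P >-> R}) :
  {ae P, forall w, 0 <= X w} ->
  ('E_P[X] =
   \int[lebesgue_measure]_(t in `[0%R, +oo[) P [set w | (t < X w)%R])%E.
Proof.
move=> X0.
have mXp : measurable_fun setT (fun w => Num.max (X w) 0).
  exact: measurable_maxr.
pose Xp : {RV P >-> R} := mfun_Sub (mem_set mXp).
have Xp0 w : 0 <= Xp w by rewrite /= le_max lexx orbT.
transitivity ('E_P[Xp])%E.
  rewrite !expectation_def; apply: ae_eq_integral => //.
  - exact/measurable_EFinP.
  - exact/measurable_EFinP.
  - by apply: filterS X0 => w Xw _ /=; rewrite max_l.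
rewrite ge0_expectation_ccdf//; apply: eq_integral => t /[!inE]/=.
rewrite in_itv/= andbT => t0; rewrite /ccdf /distribution /pushforward.
congr (P _); apply/seteqP; split => w /=; rewrite in_itv/= andbT lt_max.
  by rewrite [X in _ || X]ltNge t0 orbF.
by move=> ->.
Qed.

End conditional_expectation.

Theorem corollary1 (R : realType) (d : measure_display)
    (Omega : measurableType d) (P : probability Omega R)
    (alpha eta sigma : R)
    (X H : R -> {RV P >-> R}) (L : R -> R -> Omega -> R)
    (e : nat -> {RV P >-> R})
    (mpos : forall i,
      measurable (positive_at (Xbar eta sigma X H L) (e i))) :
  0 < alpha -> alpha < 1 -> 0 < eta -> 0 < sigma ->
  reflecting_brownian_motion P X ->
  local_time P X L ->
  stable_subordinator P alpha H ->
  independent_processes P X H ->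
  holding_times P alpha eta sigma (Xbar eta sigma X H L) e mpos ->
  forall i : nat, ('E_(cond_prob P (mpos i))[e i] = +oo)%E.
Proof.
move=> alpha0 alpha1 eta0 sigma0 _ _ _ _ [e_ge0 _ _ law] i.
rewrite (ae_ge0_expectation_ccdf (ae_cond_prob (mpos i) (e_ge0 i))).
have c0 : 0 < sigma / eta by rewrite divr_gt0.
rewrite -(integral_mittag_leffler_infty alpha0 c0 _ alpha1).
  apply: eq_integral => t /[!inE]/=; rewrite in_itv/= andbT; exact: law.
by move=> t t0; rewrite -lee_fin -(law i).
Qed.
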